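(* Let $G\in\mathcal{SC}_{m+2}(m)$. Then $G$ can be obtained from a butterfly digraph by attaching an ear; that is, $G$ is isomorphic to a digraph obtained from some butterfly digraph $\mathcal{B}^{\,t}_{k_1,k_2}$ by attaching one ear of some length $l\ge 0$ from a vertex $u$ to a vertex $v$ of $\mathcal{B}^{\,t}_{k_1,k_2}$ (possibly $u=v$).
   Context: Digraphs are finite; loops are allowed, multiple edges are not. For positive integers $m$ and $q\ge m$, $\mathcal{SC}_q(m)$ is the class of strongly connected digraphs with exactly $m$ vertices and exactly $q$ edges. Butterfly digraph: for positive integers $k_1,k_2,t$ with $1\le t\le\min\{k_1,k_2\}$, a $(t,k_1,k_2)$-butterfly digraph $\mathcal{B}^{\,t}_{k_1,k_2}$ is a digraph in $\mathcal{SC}_{m'+1}(m')$, where $m'=k_1+k_2-t$, containing as subgraphs two distinct directed simple cycles $\mathcal{C}_{k_1},\mathcal{C}_{k_2}$ with $|V(\mathcal{C}_{k_1})|=k_1$, $|V(\mathcal{C}_{k_2})|=k_2$ and $|V(\mathcal{C}_{k_1})\cap V(\mathcal{C}_{k_2})|=t$. (A loop is a directed cycle with one vertex.) Attaching an ear of length $l\ge0$ from a vertex $u$ to a vertex $v$ means adding $l$ new vertices $e_1,\dots,e_l$ and the $l+1$ edges of the path $u\to e_1\to\cdots\to e_l\to v$ (for $l=0$, the single edge $u\to v$). *)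

(* Defs.v *)
From HB Require Import structures.
From mathcomp Require Import all_boot.

Set Implicit Arguments.
Unset Strict Implicit.
Unset Printing Implicit Defensive.

(* Edges form a relation: loops are allowed, multiple edges are not. *)
Record digraph : Type := Digraph { vertex : finType; edge : rel vertex }.

Definition edge_set (G : digraph) : {set vertex G * vertex G} :=
  [set p | edge p.1 p.2].

Definition strongly_connected (G : digraph) : Prop :=
  forall x y : vertex G, connect (@edge G) x y.

Definition in_SC (q m : nat) (G : digraph) : Prop :=
  [/\ 0 < m, m <= q, #|vertex G| = m, #|edge_set G| = q
    & strongly_connected G].

Definition digraph_iso (G H : digraph) : Prop :=
  exists f : vertex G -> vertex H,
    bijective f /\ forall x y, edge (f x) (f y) = edge x y.

(* A directed simple cycle is given by its vertices listed in cyclic order;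
   the list [:: x] stands for the loop at x. *)
Definition simple_cycle (G : digraph) (k : nat) (c : seq (vertex G)) : Prop :=
  [/\ 0 < k, size c = k, uniq c & cycle (@edge G) c].

Definition cycle_vertices (G : digraph) (c : seq (vertex G)) :
  {set vertex G} := [set x in c].

Definition cycle_edges (G : digraph) (c : seq (vertex G)) :
  {set vertex G * vertex G} := [set (x, next c x) | x in c].

(* Unlike the list c, this does not depend on the starting vertex, so cycles
   are compared through it. *)
Definition cycle_subgraph (G : digraph) (c : seq (vertex G)) :
  {set vertex G} * {set vertex G * vertex G} :=
  (cycle_vertices c, cycle_edges c).

Definition butterfly (t k1 k2 : nat) (B : digraph) : Prop :=
  [/\ 0 < k1, 0 < k2, 1 <= t <= minn k1 k2,
      in_SC (k1 + k2 - t).+1 (k1 + k2 - t) B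
    & exists c1 c2 : seq (vertex B),
        [/\ simple_cycle k1 c1, simple_cycle k2 c2,
            cycle_subgraph c1 != cycle_subgraph c2
          & #|cycle_vertices c1 :&: cycle_vertices c2| = t]].

(* The new vertex e_(i+1) of the ear is inr i, for i < l. *)
Definition ear_edge (B : digraph) (u v : vertex B) (l : nat) :
  rel (vertex B + 'I_l) := fun a b =>
  match a, b with
  | inl x, inl y => edge x y || [&& l == 0, x == u & y == v]
  | inl x, inr j => (x == u) && (j == 0 :> nat)
  | inr i, inr j => j == i.+1 :> nat
  | inr i, inl y => (i.+1 == l) && (y == v)
  end.

Definition attach_ear (B : digraph) (u v : vertex B) (l : nat) : digraph :=
  Digraph (@ear_edge B u v l).

(* An ear of length 0 must add an edge, so u -> v may not already be there;
   longer ears are always edge-disjoint from B. *)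
Definition can_attach_ear (B : digraph) (u v : vertex B) (l : nat) : Prop :=
  l = 0 -> ~~ edge u v.

(* Main.v *)
(* Let (S, E) be a strongly connected subgraph of G other than G. Some edge of
   G outside E starts in S; following it by a path back to S up to the first
   vertex of S gives an ear, and adding it keeps the subgraph strongly connected
   and raises |E| - |S| by one. Starting from one vertex, where this difference
   is -1, the first ear gives a cycle, the second a butterfly, and after the
   third the difference is 2, which forces the subgraph to be all of G. *)
Require Import Defs.
From HB Require Import structures.
From mathcomp Require Import all_boot zify.

Set Implicit Arguments.
Unset Strict Implicit.
Unset Printing Implicit Defensive.

(** * Subgraphs and ears inside a digraph *)

Definition rel_of (T : finType) (E : {set T * T}) : rel T :=
  fun a b => (a, b) \in E.

(** Vertex and edge sets inside [G], rather than a digraph of its own, so that adding an ear is a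
    plain union. *)
Definition strong_sub (G : digraph) (S : {set vertex G})
    (E : {set vertex G * vertex G}) : Prop :=
  [/\ E \subset edge_set G,
      forall a b, (a, b) \in E -> a \in S /\ b \in S,
      {in S &, forall x y, connect (rel_of E) x y}
    & S != set0].

(* The first edge of the ear goes from u to nth v p 0, which is v if p is
   empty. *)
Definition is_ear (G : digraph) (S : {set vertex G})
    (E : {set vertex G * vertex G}) (u : vertex G) (p : seq (vertex G))
    (v : vertex G) : Prop :=
  [/\ u \in S, v \in S, uniq p, {in p, forall x, x \notin S}
    & path (@edge G) u (rcons p v) /\ (u, nth v p 0) \notin E].

(* The default v of nth makes index size p the last edge, into v. *)
Definition path_edges (T : finType) (u : T) (p : seq T) (v : T) :
    {set T * T} :=
  [set (nth u (u :: p) i, nth v p i) | i : 'I_(size p).+1].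

Lemma connect_last (T : finType) (e : rel T) (x y : T) (p : seq T) :
  path e x p -> y \in x :: p -> connect e y (last x p).
Proof.
move=> + yp; case/splitPl: yp => p1 p2 <-.
rewrite cat_path last_cat => /andP[_ ep].
by apply/connectP; exists p2.
Qed.

(** Meant for the second cycle: [v :: r] is the arc ending in [u], and the ear [q] follows. If [q]
    is empty the cycle closes up at [v], the default value. *)
Lemma next_last_cat (T : eqType) (v : T) (r q : seq T) :
  uniq (v :: r ++ q) -> next (v :: r ++ q) (last v r) = nth v q 0.
Proof.
rewrite next_nth -cat_cons cat_uniq => /andP[Ur _].
by rewrite mem_cat mem_last index_cat mem_last index_last // nth_cat ltnn subnn.
Qed.

Lemma path_edgesP (T : finType) (u v : T) (p : seq T) (a b : T) :
  reflect (exists2 i, i <= size p & a = nth u (u :: p) i /\ b = nth v p i)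
          ((a, b) \in path_edges u p v).
Proof.
apply: (iffP imsetP) => [[i _ [-> ->]]|[i lti [-> ->]]].
  by exists i => //; rewrite -ltnS.
by exists (Ordinal (lti : i < (size p).+1)).
Qed.

(** The sources of the edges are already pairwise distinct. *)
Lemma card_path_edges (T : finType) (u v : T) (p : seq T) :
  uniq (u :: p) -> #|path_edges u p v| = (size p).+1.
Proof.
move=> Up; rewrite card_imset ?card_ord // => i j [/eqP + _].
by rewrite nth_uniq //= => /eqP/val_inj.
Qed.

Lemma path_path_edges (T : finType) (u v : T) (p : seq T) :
  path (rel_of (path_edges u p v)) u (rcons p v).
Proof.
apply/(pathP u) => i; rewrite size_rcons ltnS => lti.
apply/path_edgesP; exists i => //; split.
  by rewrite -rcons_cons nth_rcons /= ltnS lti.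
rewrite nth_rcons; case: ltngtP lti => // [ltip|->] _.
  exact: set_nth_default.
by rewrite nth_default.
Qed.

Lemma path_edges_sub (G : digraph) (u v : vertex G) (p : seq (vertex G)) :
  path (@edge G) u (rcons p v) -> path_edges u p v \subset edge_set G.
Proof.
move=> /(pathP u) ep; apply/subsetP => -[a b] /path_edgesP[i lei [-> ->]].
have := ep i; rewrite size_rcons ltnS => /(_ lei).
rewrite inE /= -rcons_cons nth_rcons /= ltnS lei nth_rcons.
case: ltngtP lei => // [ltip|->] _; first by rewrite (set_nth_default u v).
by rewrite [nth v p _]nth_default.
Qed.

Lemma lift_seq (T : finType) (P : {set T}) (c : seq T) :
  {subset c <= P} -> exists c' : seq {x | x \in P}, map val c' = c.
Proof.
elim: c => [|x c IH] cP; first by exists [::].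
have [c' <-] : exists c' : seq {x | x \in P}, map val c' = c.
  by apply: IH => y yc; apply: cP; rewrite inE yc orbT.
by have xP : x \in P by [apply: cP; rewrite inE eqxx]; exists (Sub x xP :: c').
Qed.

(** * Growing strongly connected subgraphs by ears *)

Section StrongSub.
Variable G : digraph.
Implicit Types (S : {set vertex G}) (E : {set vertex G * vertex G}).

Lemma strong_sub_full S E : strongly_connected G -> strong_sub S E ->
  E = edge_set G -> S = [set: vertex G].
Proof.
move=> cG [_ ES _ /set0Pn[x xS]] EG; apply/setP => y; rewrite inE.
have /connectP[p] := cG x y; elim: p x xS => [|z p IH] x xS /=.
  by move=> _ ->.
move=> /andP[xz zp]; apply: IH zp; case: (ES x z) => //.
by rewrite EG inE.
Qed.

Lemma leaving_edge S (x y : vertex G) : x \in S -> y \notin S ->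
  connect (@edge G) x y -> exists a b, [/\ a \in S, b \notin S & edge a b].
Proof.
move=> + yS /connectP[p].
elim: p x => [|z p IH] x /= xS; first by move=> _ yx; rewrite yx xS in yS.
move=> /andP[xz zp] yl; have [zS|zS] := boolP (z \in S); first exact: IH zp yl.
by exists x, z.
Qed.

Lemma ear_exists S E : strongly_connected G -> strong_sub S E ->
  E != edge_set G -> exists u p v, is_ear S E u p v.
Proof.
move=> cG [EG ES _ /set0Pn[x xS]] nEG.
have [a [b [aS abE ab]]] : exists a b, [/\ a \in S, (a, b) \notin E & edge a b].
  have : E \proper edge_set G by rewrite properEneq nEG.
  case/properP=> _ [[a b]]; rewrite inE /= => ab abE.
  have [aS|aS] := boolP (a \in S); first by exists a, b.
  (* If the missing edge starts outside [S], a path from [S] to its source leaves [S] by another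
     edge, which is not in [E] because its target is not in [S]. *)
  have [c [d [cS dS cd]]] := leaving_edge xS aS (cG x a).
  by exists c, d; split=> //; apply: contra dS => /ES[].
have /connectP[q0 q0P aq0] := cG b a.
case/shortenP: q0P aq0 => q qP Uq _ aq {q0}.
have hS : has (mem S) (b :: q).
  by apply/hasP; exists a => //; rewrite aq mem_last.
have abq : path (@edge G) a (b :: q) by rewrite /= ab.
(* Kept because the split below hides that the list starts with [b], which identifies the first edge
   of the ear. *)
have : head a (b :: q) = b by [].
(* [v] is the first vertex of [b :: q] in [S]; [p] is empty when [b] itself lies in [S]. *)
move: hS Uq abq; case/split_find => v p r vS pS.
rewrite cat_uniq rcons_uniq cat_path => /andP[/andP[_ Up] _] /andP[ep _] hb.
exists a, p, v; split=> //.
  by move=> y yp; apply: contra pS => yS; apply/hasP; exists y.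
split=> //; suff -> : nth v p 0 = b by [].
by rewrite -hb; case: (p).
Qed.

(** Every vertex reaches [v] and is reached from [u], along the ear or inside [S]; the old subgraph
    connects [v] to [u]. *)
Lemma strong_sub_ear S E u p v : strong_sub S E -> is_ear S E u p v ->
  strong_sub (S :|: [set x in p]) (E :|: path_edges u p v).
Proof.
move=> [EG ES cS nS] [uS vS Up pS [ep _]].
set E' := E :|: _; have eP : path (rel_of E') u (rcons p v).
  apply: sub_path (path_path_edges u v p) => a b ab.
  by rewrite /rel_of inE; apply/orP; right.
have lS x y : x \in S -> y \in S -> connect (rel_of E') x y.
  move=> xS yS; apply: connect_sub (cS x y xS yS) => a b ab.
  by apply: connect1; rewrite /rel_of inE; apply/orP; left.
have toS x : x \in S :|: [set x in p] -> connect (rel_of E') x v.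
  rewrite !inE => /orP[xS|xp]; first exact: lS.
  rewrite -[X in connect _ _ X](last_rcons u p v); apply: connect_last eP _.
  by rewrite inE mem_rcons inE xp !orbT.
have ofS x : x \in S :|: [set x in p] -> connect (rel_of E') u x.
  rewrite !inE => /orP[xS|xp]; first exact: lS.
  by apply: (path_connect eP); rewrite inE mem_rcons inE xp !orbT.
split.
- by rewrite subUset EG path_edges_sub.
- move=> a b; rewrite inE => /orP[/ES[aS bS]|/path_edgesP[i lei [-> ->]]].
    by rewrite !inE aS bS.
  split; rewrite !inE.
    by case: i lei => [|i] lei /=; rewrite ?uS // mem_nth // orbT.
  case: ltngtP lei => // [ltip|->] _; first by rewrite mem_nth // orbT.
  by rewrite nth_default // vS.
- move=> x y xS yS; apply: connect_trans (toS x xS) _.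
  by apply: connect_trans (ofS y yS); apply: lS.
- by case/set0Pn: nS => x xS; apply/set0Pn; exists x; rewrite inE xS.
Qed.

Lemma card_ear_vertices S E u p v : is_ear S E u p v ->
  #|S :|: [set x in p]| = #|S| + size p.
Proof.
move=> [_ _ Up pS _]; rewrite cardsU cardsE (card_uniqP Up).
suff -> : S :&: [set x in p] = set0 by rewrite cards0 subn0.
apply/setP => x; rewrite !inE; apply/negP => /andP[xS /pS].
by rewrite xS.
Qed.

(** No ear edge is in [E]: the first by definition, the others because their sources lie outside
    [S]. *)
Lemma card_ear_edges S E u p v : strong_sub S E -> is_ear S E u p v ->
  #|E :|: path_edges u p v| = #|E| + (size p).+1.
Proof.
move=> [_ ES _ _] [uS _ Up pS [_ uvE]]; rewrite cardsU card_path_edges; last first.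
  by rewrite /= Up andbT; apply/negP => /pS; rewrite uS.
suff -> : E :&: path_edges u p v = set0 by rewrite cards0 subn0.
apply/setP => -[a b]; rewrite in_setI in_set0; apply/negP => /andP[abE].
case/path_edgesP => -[|i] lei [a_ b_]; first by rewrite a_ b_ (negPf uvE) in abE.
have [aS _] := ES _ _ abE.
by have := pS a; rewrite aS => /(_ _)/negP; apply=> //; rewrite a_ /= mem_nth.
Qed.

(* Every ear raises [#|E| - #|S|] by one; written without subtraction. *)
Lemma strong_sub_excess S E : strongly_connected G -> strong_sub S E ->
  E != edge_set G -> #|E| + #|vertex G| < #|edge_set G| + #|S|.
Proof.
move=> cG; have [n] := ubnP (#|edge_set G| - #|E|).
elim: n S E => // n IH S E leN sE nE.
have [u [p [v earE]]] := ear_exists cG sE nE.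
have sE' := strong_sub_ear sE earE.
have cS := card_ear_vertices earE; have cE := card_ear_edges sE earE.
have [eE|nE'] := eqVneq (E :|: path_edges u p v) (edge_set G).
  by move: cS cE; rewrite (strong_sub_full cG sE' eE) eE cardsT; lia.
(* This bound makes the truncated difference in the induction drop strictly. *)
have [subE _ _ _] := sE'; have := subset_leq_card subE.
have := IH _ _ _ sE' nE'; lia.
Qed.

(** * Subgraphs as digraphs: butterflies and attached ears *)

Definition sub_digraph S E : digraph :=
  @Digraph {x : vertex G | x \in S} (fun a b => (val a, val b) \in E).

Lemma sub_digraph_in_SC S E : strong_sub S E -> #|S| <= #|E| ->
  in_SC #|E| #|S| (sub_digraph S E).
Proof.
move=> [_ ES cS nS] leSE; split=> //.
- by rewrite card_gt0.
- by rewrite card_sig; apply: eq_card.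
- have valI : injective (fun ab : vertex (sub_digraph S E) * vertex (sub_digraph S E) =>
    (val ab.1, val ab.2)) by move=> [a b] [c d] /= [/val_inj-> /val_inj->].
  rewrite -(card_imset _ valI); congr #|pred_of_set _|.
  apply/setP => -[a b]; apply/imsetP/idP => [[[a' b']]|abE].
    by rewrite inE /= => ab [-> ->].
  have [aS bS] := ES a b abE.
  by exists (Sub a aS, Sub b bS); rewrite ?inE.
- move=> [x xS] [y yS]; have /connectP[p] := cS x y xS yS.
  elim: p x xS => [|z p IH] x xS /=.
    by move=> _ yx; rewrite yx in yS *; rewrite (bool_irrelevance yS xS).
  move=> /andP[xz zp] yl; have [_ zS] := ES _ _ xz.
  by apply: connect_trans (IH z zS zp yl); apply: connect1.
Qed.

(** Inclusion-exclusion gives [#|S|] in terms of [t], the number of common vertices; different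
    successors of [u] make the cycles distinct. *)
Lemma sub_digraph_butterfly S E c1 c2 u : strong_sub S E -> #|E| = #|S|.+1 ->
  uniq c1 -> uniq c2 -> cycle (rel_of E) c1 -> cycle (rel_of E) c2 ->
  S = [set x in c1] :|: [set x in c2] -> u \in c1 -> u \in c2 ->
  next c1 u != next c2 u ->
  exists t, butterfly t (size c1) (size c2) (sub_digraph S E).
Proof.
move=> sE cE U1 U2 C1 C2 defS u1 u2 nu.
have [c1' ec1] : exists c' : seq {x | x \in S}, map val c' = c1.
  by apply: lift_seq => x xc; rewrite defS !inE xc.
have [c2' ec2] : exists c' : seq {x | x \in S}, map val c' = c2.
  by apply: lift_seq => x xc; rewrite defS !inE xc orbT.
have uS : u \in S by rewrite defS !inE u1.
set u' : vertex (sub_digraph S E) := Sub u uS.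
have memv (c : seq {x | x \in S}) x : (val x \in map val c) = (x \in c).
  by rewrite mem_map //; apply: val_inj.
have u1' : u' \in c1' by rewrite -memv ec1.
have u2' : u' \in c2' by rewrite -memv ec2.
have card_c (c : seq (vertex (sub_digraph S E))) : uniq (map val c) ->
    #|cycle_vertices c| = size (map val c).
  by move=> /map_uniq/card_uniqP Uc; rewrite size_map -Uc cardsE.
set A := cycle_vertices (c1' : seq (vertex (sub_digraph S E))).
set B := cycle_vertices (c2' : seq (vertex (sub_digraph S E))).
have cA : #|A| = size c1 by rewrite card_c ec1.
have cB : #|B| = size c2 by rewrite card_c ec2.
have AB : A :|: B = setT.
  apply/setP => x; rewrite !inE -!memv ec1 ec2.
  by have := congr1 (fun X : {set _} => val x \in X) defS; rewrite (valP x) !inE.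
have cS : #|S| = size c1 + size c2 - #|A :&: B|.
  by rewrite -cA -cB -cardsU AB cardsT card_sig; apply: eq_card.
exists #|A :&: B|; split.
- by case: (c1) u1.
- by case: (c2) u2.
- apply/andP; split; first by rewrite card_gt0; apply/set0Pn; exists u'; rewrite !inE u1'.
  by rewrite leq_min -cA -cB !subset_leq_card ?subsetIl ?subsetIr.
- by rewrite -cS -cE; apply: sub_digraph_in_SC => //; rewrite cE.
exists c1', c2'; split=> //.
- split; [by case: (c1) u1 | by rewrite -ec1 size_map | by apply: (@map_uniq _ _ val); rewrite ec1|].
  by rewrite -ec1 cycle_map in C1.
- split; [by case: (c2) u2 | by rewrite -ec2 size_map | by apply: (@map_uniq _ _ val); rewrite ec2|].
  by rewrite -ec2 cycle_map in C2.
(* With equal edge sets, the edge leaving [u] on the first cycle would also be the one leaving it on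
   the second. *)
apply: contra nu => /eqP[_ eE].
have : (u', next c1' u') \in cycle_edges (c1' : seq (vertex (sub_digraph S E))).
  by apply/imsetP; exists u'.
rewrite eE => /imsetP[w _ [<- e]].
rewrite -ec1 -ec2 -[u]/(val u') !(next_map val_inj).
- exact/eqP/(congr1 val e).
- by apply: (@map_uniq _ _ val); rewrite ec2.
- by apply: (@map_uniq _ _ val); rewrite ec1.
Qed.

(** The natural map [g] goes from the abstract digraph to [G], so edges are compared along [g] and
    the isomorphism is its inverse [f]. *)
Lemma sub_digraph_ear_iso S E u p v (us : u \in S) (vs : v \in S) :
  is_ear S E u p v -> strong_sub S E ->
  S :|: [set x in p] = setT -> E :|: path_edges u p v = edge_set G ->
  digraph_iso G (@attach_ear (sub_digraph S E) (Sub u us) (Sub v vs) (size p)).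
Proof.
move=> [_ _ Up pS _] [_ ES _ _] eS eE.
pose H := @attach_ear (sub_digraph S E) (Sub u us) (Sub v vs) (size p).
pose g (a : vertex H) : vertex G :=
  match a with inl x => val x | inr i => nth u p i end.
have gI : injective g.
  move=> [x|i] [y|j] /=.
  - by move/val_inj->.
  - by move=> e; have := pS _ (mem_nth u (ltn_ord j)); rewrite -e (valP x).
  - by move=> e; have := pS _ (mem_nth u (ltn_ord i)); rewrite e (valP y).
  - by move/eqP; rewrite nth_uniq // => /eqP/val_inj->.
have gS x : exists a, g a == x.
  have : x \in S :|: [set x in p] by rewrite eS inE.
  rewrite !inE => /orP[xS|/(nthP u)[i lti <-]].
    by exists (inl (Sub x xS)).
  by exists (inr (Ordinal lti)).
pose f x := xchoose (gS x).
have fK : cancel f g by move=> x; apply/eqP/(xchooseP (gS x)).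
have gK : cancel g f by move=> a; apply: gI; rewrite fK.
exists f; split; first by exists g.
suff E' a b : edge a b = edge (g a) (g b) by move=> x y; rewrite E' !fK.
have -> : edge (g a) (g b) = ((g a, g b) \in edge_set G) by rewrite inE.
rewrite -eE in_setU.
have pE i : i < size p -> (nth u p i \in S) = false.
  by move=> lti; apply/negbTE/pS/mem_nth.
case: a b => [x|i] [y|j] /=.
(* Old to old: only index 0 has its source in [S], and its target is in [S] only if [p] is empty. *)
- congr orb; apply/and3P/path_edgesP => [[/eqP/size0nil p0 /eqP-> /eqP->]|].
    by exists 0; rewrite // p0.
  move=> [[|i] lei [xi yi]]; last by have := valP x; rewrite /= xi /= pE.
  case: (posnP (size p)) => [p0|lp].
    split=> //; first exact/eqP/val_inj.
    by apply/eqP/val_inj; apply: etrans yi _; rewrite nth_default // p0.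
  by have := valP y; rewrite /= yi (set_nth_default u) // pE.
- have -> : ((val x, nth u p j) \in E) = false.
    by apply/negP => /ES[_]; rewrite pE.
  apply/andP/path_edgesP => [[/eqP-> /eqP j0]|].
    by exists 0 => //; split=> //; rewrite j0 (set_nth_default v) // -j0.
  move=> [[|i] lei [xi yi]]; last by have := valP x; rewrite /= xi /= pE.
  split; first exact/eqP/val_inj.
  have lp : 0 < size p by apply: leq_ltn_trans (ltn_ord j).
  by move/eqP: yi; rewrite (set_nth_default u v) // nth_uniq.
(* New to old: only the last edge, of index [size p], ends in [S]. *)
- have -> : ((nth u p i, val y) \in E) = false.
    by apply/negP => /ES[]; rewrite pE.
  apply/andP/path_edgesP => [[/eqP iN /eqP->]|].
    by exists i.+1 => //; split=> //; rewrite iN nth_default.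
  move=> [k lek [xi yi]].
  have kN : k = size p.
    case: ltngtP lek => // ltk _.
    by have := valP y; rewrite /= yi (set_nth_default u) // pE.
  case: k lek kN xi yi => [|k] lek kN xi yi.
    by have := pE i (ltn_ord i); rewrite xi /= us.
  split; last by apply/eqP/val_inj; apply: etrans yi _; rewrite nth_default // kN.
  by move/eqP: xi; rewrite /= nth_uniq // => /eqP->; rewrite kN.
(* New to new: the edge leaving [nth u p i] has index [i.+1], since sources are counted from [u]. *)
- have -> : ((nth u p i, nth u p j) \in E) = false.
    by apply/negP => /ES[]; rewrite pE.
  apply/eqP/path_edgesP => [ij|].
    exists i.+1 => //; split=> //.
    by rewrite -ij (set_nth_default v).
  move=> [[|k] lek [xi yi]]; first by have := pE i (ltn_ord i); rewrite xi /= us.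
  move/eqP: xi; rewrite /= nth_uniq // => /eqP->.
  move: lek; rewrite /= leq_eqVlt => /orP[/eqP ek|ltk].
    by have := pE j (ltn_ord j); rewrite yi nth_default ?vs // ek.
  by move/eqP: yi; rewrite (set_nth_default u v) // nth_uniq // => /eqP.
Qed.

End StrongSub.

(** * Three ears: a cycle, a butterfly, the whole digraph *)

Theorem corollary3p4 (m : nat) (G : digraph) (hG : in_SC (m + 2) m G) :
  exists (t k1 k2 : nat) (B : digraph) (u v : vertex B) (l : nat),
    [/\ butterfly t k1 k2 B,
        can_attach_ear u v l
      & digraph_iso G (attach_ear u v l)].
Proof.
case: hG => m0 _ cV cE cG.
have [x0 _] : exists x0, x0 \in vertex G by apply/card_gt0P; rewrite cV.
have s0 : strong_sub [set x0] (set0 : {set vertex G * vertex G}).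
  split; rewrite ?sub0set //.
  - by move=> a b; rewrite in_set0.
  - by move=> x y /set1P-> /set1P->; apply: connect0.
  - by apply/set0Pn; exists x0; rewrite inE.
(* While [#|E| - #|S|] differs from 2, some edge is missing and the next ear exists. *)
have full S (E : {set vertex G * vertex G}) : strong_sub S E ->
    E = edge_set G -> #|E| = #|S| + 2.
  by move=> sE eE; rewrite (strong_sub_full cG sE eE) eE cardsT cE cV.
have [|u1 [p1 [v1 ear1]]] := ear_exists cG s0.
  by apply/eqP => /(full _ _ s0); rewrite cards0 addn2.
have s1 := strong_sub_ear s0 ear1.
have cS1 := card_ear_vertices ear1; have cE1 := card_ear_edges s0 ear1.
(* Both ends of the first ear are [x0], so it closes to a cycle. *)
have [/set1P eu1 /set1P ev1 Up1 pS1 _] := ear1.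
move: (path_path_edges u1 v1 p1) s1 cS1 cE1; rewrite eu1 ev1.
set S1 := [set x0] :|: _; set E1 := set0 :|: _ => cyc1 s1 cS1 cE1 {ear1 eu1 ev1 u1 v1}.
have {cyc1}C1 : cycle (rel_of E1) (x0 :: p1) by rewrite /E1 set0U.
have U1 : uniq (x0 :: p1).
  by rewrite /= Up1 andbT; apply/negP => /pS1; rewrite inE eqxx.
have [|u [q [v ear2]]] := ear_exists cG s1.
  by apply/eqP => /(full _ _ s1); rewrite cE1 cS1 cards0 cards1; lia.
have s2 := strong_sub_ear s1 ear2.
have cS2 := card_ear_vertices ear2; have cE2 := card_ear_edges s1 ear2.
have [uS vS Uq qS [_ uqE]] := ear2.
have Q := path_path_edges u v q.
set S2 := S1 :|: _ in s2 cS2; set E2 := E1 :|: _ in s2 cE2.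
have c2 : #|E2| = #|S2|.+1.
  by rewrite cE2 cS2 cE1 cS1 cards0 cards1; lia.
have memS1 x : (x \in S1) = (x \in x0 :: p1) by rewrite !inE.
have [|u3 [l [v3 ear3]]] := ear_exists cG s2.
  by apply/eqP => /(full _ _ s2); rewrite c2; lia.
have s3 := strong_sub_ear s2 ear3.
have cS3 := card_ear_vertices ear3; have cE3 := card_ear_edges s2 ear3.
have eE3 : E2 :|: path_edges u3 l v3 = edge_set G.
  (* The difference is now 2; a missing edge would force it below 2. *)
  apply/eqP; apply: contraT => /(strong_sub_excess cG s3).
  by rewrite cE3 cS3 c2 cE cV; lia.
have eS3 := strong_sub_full cG s3 eE3.
have [us vs _ _ [_ uvE]] := ear3.
have iso := sub_digraph_ear_iso us vs ear3 s2 eS3 eE3.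
(* Closing the new path up along the arc of the first cycle from v to u gives
   the second cycle. *)
have /rot_to[i r rot_r] : v \in x0 :: p1 by rewrite -memS1.
have mem_r x : (x \in v :: r) = (x \in S1) by rewrite -rot_r mem_rot memS1.
move: C1 U1; rewrite -(rot_cycle i) -(rot_uniq i) rot_r => C1 U1.
have := uS; rewrite -mem_r => ur.
(* [v :: r1] is the arc from [v] to [u]; [r1] is empty when [u = v]. *)
case/splitPl: ur C1 U1 mem_r => r1 r2 lr1 Cr Ur mem_r.
have ur1 : u \in v :: r1 by rewrite -lr1 mem_last.
have E12 : subrel (rel_of E1) (rel_of E2).
  by move=> a b ab; rewrite /rel_of inE; apply/orP; left.
have U2 : uniq (v :: r1 ++ q).
  rewrite -cat_cons cat_uniq Uq andbT.
  move: (Ur); rewrite -cat_cons cat_uniq => /andP[-> _] /=.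
  apply/hasPn => x xq; apply: contra (qS x xq) => xr.
  by rewrite -mem_r -cat_cons mem_cat xr.
have C2 : cycle (rel_of E2) (v :: r1 ++ q).
  rewrite /= rcons_cat cat_path lr1; apply/andP; split.
    move: Cr; rewrite /= rcons_cat cat_path => /andP[+ _].
    exact: sub_path.
  by apply: sub_path Q => a b ab; rewrite /rel_of inE; apply/orP; right.
have n2 : next (v :: r1 ++ q) u = nth v q 0.
  by rewrite -lr1 next_last_cat.
have [|||||t bt] := @sub_digraph_butterfly G S2 E2 (v :: r1 ++ r2) (v :: r1 ++ q) u
  s2 c2 Ur U2 _ C2.
- exact: sub_cycle Cr.
- apply/setP => x; rewrite [in LHS]in_setU -mem_r !in_set -!cat_cons !mem_cat.
  by rewrite orbACA orbb orbA.
- by rewrite -cat_cons mem_cat ur1.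
- by rewrite -cat_cons mem_cat ur1.
(* The first cycle leaves [u] by an edge of [E1], the second by the first edge of the ear, which is
   not in [E1]. *)
- apply: contra uqE => /eqP; rewrite n2 => <-.
  by apply: (next_cycle Cr); rewrite -cat_cons mem_cat ur1.
exists t, (size (v :: r1 ++ r2)), (size (v :: r1 ++ q)), (sub_digraph S2 E2).
exists (Sub u3 us), (Sub v3 vs), (size l); split=> //.
(* For length 0 the first edge of the ear is [(u3, v3)] itself, which is not in [E2]. *)
by move=> /size0nil l0; rewrite /= l0 in uvE *.
Qed.
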